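(* For any connected and uniformly locally path-connected uniform space $X$ (and any base point $x_0\in X$), the James uniformity on $\widetilde X$ is identical with the lasso uniformity on $\widetilde X$.
   Context: Entourages of uniform structures are taken to be symmetric. For an entourage $E$ of $X$, $B(x,E)=\{y\in X : (x,y)\in E\}$; a subset of $X$ (or a path, via its image) is $E$-bounded if it is contained in $B(x,E)$ for some $x\in X$. $X$ is uniformly locally path-connected if for every entourage $E$ there is an entourage $F$ such that any pair $(x,y)\in F$ can be connected by an $E$-bounded path in $X$. $\widetilde X$ is the set of homotopy classes $[\alpha]$ (rel. end-points) of paths $\alpha\colon[0,1]\to X$ with $\alpha(0)=x_0$. The James uniform structure on $\widetilde X$ has as base the sets $E^\ast$, $E$ an entourage of $X$, where $E^\ast$ is the set of pairs of classes of the form $([\alpha],[\beta])$ such that $(\alpha,\beta)$ is a path in $E\subset X\times X$ originating at $(x_0,x_0)$ (i.e. the two classes have representatives $\alpha,\beta$ with $(\alpha(t),\beta(t))\in E$ for all $t$). An $E$-lasso based at $x\in X$ is a finite concatenation of loops of the form $\alpha_n\ast\gamma_n\ast\alpha_n^{-1}$, where each loop $\gamma_n$ is $E$-bounded and $\alpha_n$ is a path in $X$ from $x$ to $\gamma_n(0)$. The lasso uniform structure on $\widetilde X$ has as base the sets $l(E)$, $E$ an entourage of $X$, where $l(E)$ consists of pairs $([\alpha],[\beta])$ such that for some $E$-lasso $l$ based at $x_0$ the path $\alpha^{-1}\ast l\ast\beta$ is homotopic in $X$ rel. end-points to an $E$-bounded path. *)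

(* Defs.v *)
From HB Require Import structures.
From mathcomp Require Import all_boot all_order all_algebra generic_quotient.
From mathcomp Require Import all_classical all_reals all_analysis homotopy.
Import Order.TTheory GRing.Theory Num.Theory numFieldNormedType.Exports.

Set Implicit Arguments.
Unset Strict Implicit.
Unset Printing Implicit Defensive.

Local Open Scope classical_set_scope.
Local Open Scope ring_scope.
Local Open Scope quotient_scope.

Section UnitInterval.
Context (R : realType).

Definition unitI : Type := set_type `[0 : R, 1 : R].

HB.instance Definition _ := PseudoMetric.copy unitI (set_type `[0 : R, 1 : R]).

Definition unitI_val (t : unitI) : R := set_val t.

Lemma clampI_subproof (r : R) : Num.max 0 (Num.min 1 r) \in `[0 : R, 1 : R]%classic.
Proof. by rewrite mem_setE in_itv/= le_max lexx ge_max ler01 ge_min lexx. Qed.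

(* the retraction of R onto [0, 1] *)
Definition clampI (r : R) : unitI := exist (fun x => x \in `[0, 1]%classic) _ (clampI_subproof r).

Lemma unitI_ge0 (t : unitI) : 0 <= unitI_val t.
Proof.
by case: t => r rI; move: (rI); rewrite /unitI_val set_valE/= mem_setE in_itv/= => /andP[].
Qed.

Lemma unitI_le1 (t : unitI) : unitI_val t <= 1.
Proof.
by case: t => r rI; move: (rI); rewrite /unitI_val set_valE/= mem_setE in_itv/= => /andP[].
Qed.

Lemma unitI_val_inj : injective unitI_val.
Proof.
move=> [x xI] [y yI]; rewrite /unitI_val !set_valE/= => xy.
by apply: eq_exist.
Qed.

Lemma clampIK (r : R) : 0 <= r <= 1 -> unitI_val (clampI r) = r.
Proof.
by move=> /andP[r0 r1]; rewrite /unitI_val set_valE/= (min_idPr _)// (max_idPr _).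
Qed.

Lemma unitI_valK : cancel unitI_val clampI.
Proof.
move=> t; apply: unitI_val_inj.
by rewrite clampIK// unitI_ge0 unitI_le1.
Qed.

Lemma unitI_val_continuous : continuous unitI_val.
Proof. exact: initial_continuous. Qed.

Lemma clampI_continuous : continuous clampI.
Proof.
apply: continuous_comp_initial => r.
rewrite /comp/=; apply: continuous_max; first exact: cvg_cst.
by apply: continuous_min; [exact: cvg_cst|exact: cvg_id].
Qed.

Lemma clampI_neq : clampI 0 != clampI 1.
Proof.
apply/eqP => /(congr1 unitI_val); rewrite !clampIK ?lexx ?ler01//.
by move=> /esym/eqP; rewrite oner_eq0.
Qed.

HB.instance Definition _ := isBiPointed.Build unitI clampI_neq.

Lemma unitI_val0 : unitI_val zero = 0.
Proof. by rewrite clampIK// lexx ler01. Qed.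

Lemma unitI_val1 : unitI_val one = 1.
Proof. by rewrite clampIK// lexx ler01. Qed.

End UnitInterval.

Lemma continuous_paste (R : realType) (T U : topologicalType) (c : T -> R)
    (a : R) (f g : T -> U) : continuous c -> continuous f -> continuous g ->
  (forall t, c t = a -> f t = g t) ->
  continuous (fun t => if c t <= a then f t else g t).
Proof.
move=> cc cf cg fg t W /=; case: (ltgtP (c t) a) => [ta|ta|ta] nW.
- have A : \forall s \near t, c s < a.
    by apply: (cc t [set r | r < a]); apply: open_nbhs_nbhs; split => //;
      exact: open_lt.
  by move: A (cf t W nW); apply: filterS2 => s /ltW /= ->.
- have A : \forall s \near t, a < c s.
    by apply: (cc t [set r | a < r]); apply: open_nbhs_nbhs; split => //;
      exact: open_gt.
  by move: A (cg t W nW); apply: filterS2 => s; rewrite ltNge /= => /negbTE ->.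
- have nWg : nbhs (g t) W by rewrite -fg.
  have A : \forall s \near t, W (f s) by exact: cf nW.
  have B : \forall s \near t, W (g s) by exact: cg nWg.
  by apply: filterS2 A B => s /=; case: ifP.
Qed.

Section PathOperations.
Context (R : realType) (X : topologicalType).
Implicit Types x y z : X.
Local Notation I := (unitI R).

(* [chain_path p q] of homotopy.v is defined on the wedge of two copies of I;
   cat_fun is its reparametrisation by I itself. *)
Definition cat_fun (p q : I -> X) (t : I) : X :=
  if unitI_val t <= 2^-1 then p (clampI (2 * unitI_val t))
  else q (clampI (2 * unitI_val t - 1)).

Definition rev_fun (p : I -> X) (t : I) : X := p (clampI (1 - unitI_val t)).

Lemma continuous_affine_clampI (T : topologicalType) (c : T -> R) (a b : R) :
  continuous c -> continuous (fun t => clampI (a * c t + b)).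
Proof.
move=> cc t; apply: (@continuous_comp _ _ _ (fun t => a * c t + b) (@clampI R)).
  apply: cvgD; last exact: cvg_cst.
  by apply: cvgM; [exact: cvg_cst|exact: cc].
exact: clampI_continuous.
Qed.

Section Cat.
Context (x y z : X) (p : {path I from x to y}) (q : {path I from y to z}).

Lemma cat_fun_continuous : continuous (cat_fun p q).
Proof.
apply: continuous_paste.
- exact: unitI_val_continuous.
- move=> t; apply: (@continuous_comp _ _ _
    (fun s : I => clampI (2 * unitI_val s)) p); last exact: cts_fun.
  rewrite (_ : (fun s : I => _) = fun s => clampI (2 * unitI_val s + 0)).
    exact: continuous_affine_clampI (@unitI_val_continuous R) _.
  by apply/funext => s; rewrite addr0.
- move=> t; apply: (@continuous_comp _ _ _
    (fun s : I => clampI (2 * unitI_val s - 1)) q); last exact: cts_fun.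
  exact: continuous_affine_clampI (@unitI_val_continuous R) _.
- move=> t ->; rewrite divff// subrr.
  by rewrite -[clampI 1]/one -[clampI 0]/zero path_one path_zero.
Qed.

Lemma cat_fun0 : cat_fun p q zero = x.
Proof.
by rewrite /cat_fun unitI_val0 invr_ge0 ler0n mulr0 -[clampI 0]/zero path_zero.
Qed.

Lemma cat_fun1 : cat_fun p q one = z.
Proof.
rewrite /cat_fun unitI_val1 leNgt invf_lt1 ?ltr0n// ltr1n/= mulr1.
by rewrite -[2 : R]/(1 + 1) addrK -[clampI 1]/one path_one.
Qed.

Definition path_cat : {path I from x to z} :=
  mk_path cat_fun_continuous cat_fun0 cat_fun1.

Lemma rev_fun_continuous : continuous (rev_fun p).
Proof.
move=> t; apply: (@continuous_comp _ _ _
  (fun s : I => clampI (1 - unitI_val s)) p); last exact: cts_fun.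
rewrite (_ : (fun s : I => _) = fun s => clampI (-1 * unitI_val s + 1)).
  exact: continuous_affine_clampI (@unitI_val_continuous R) _.
by apply/funext => s; rewrite mulN1r addrC.
Qed.

Lemma rev_fun0 : rev_fun p zero = y.
Proof. by rewrite /rev_fun unitI_val0 subr0 -[clampI 1]/one path_one. Qed.

Lemma rev_fun1 : rev_fun p one = x.
Proof. by rewrite /rev_fun unitI_val1 subrr -[clampI 0]/zero path_zero. Qed.

Definition path_rev : {path I from y to x} :=
  mk_path rev_fun_continuous rev_fun0 rev_fun1.

End Cat.

(* Homotopy rel. end-points. It is stated for bare maps, so that it compares
   paths whose end-points are not syntactically the same; it forces the
   end-points of f and g to agree. *)
Definition path_homotopic (f g : I -> X) : Prop :=
  exists H : I * I -> X, [/\ continuous H,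
    forall t, H (t, zero) = f t,
    forall t, H (t, one) = g t,
    forall s, H (zero, s) = f zero &
    forall s, H (one, s) = f one].

Lemma path_homotopic_refl (f : I -> X) : continuous f -> path_homotopic f f.
Proof.
move=> cf; exists (f \o fst); split => // -[t s].
by apply: continuous_comp; [exact: cvg_fst|exact: cf].
Qed.

Lemma continuous_clamp_snd (a b : R) :
  continuous (fun u : I * I => (u.1, clampI (a * unitI_val u.2 + b))).
Proof.
have cA : continuous (fun u : I * I => clampI (a * unitI_val u.2 + b)).
  apply: continuous_affine_clampI => v.
  by apply: continuous_comp; [exact: cvg_snd|exact: unitI_val_continuous].
by move=> [t s]; exact: cvg_pair (@cvg_fst _ _ _ _ _) (cA (t, s)).
Qed.

Lemma path_homotopic_sym (f g : I -> X) :
  path_homotopic f g -> path_homotopic g f.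
Proof.
move=> [H [cH H0 H1 Hl Hr]].
exists (H \o (fun u : I * I => (u.1, clampI (-1 * unitI_val u.2 + 1)))).
split => [u|t|t|s|s] /=.
- by apply: continuous_comp; [exact: continuous_clamp_snd|exact: cH].
- by rewrite unitI_val0 mulr0 add0r -[clampI 1]/one H1.
- by rewrite unitI_val1 mulr1 addNr -[clampI 0]/zero H0.
- by rewrite Hl -H1 Hl.
- by rewrite Hr -H1 Hr.
Qed.

Lemma path_homotopic_trans (g f h : I -> X) :
  path_homotopic f g -> path_homotopic g h -> path_homotopic f h.
Proof.
move=> [H [cH H0 H1 Hl Hr]] [K [cK K0 K1 Kl Kr]].
have fg0 : g zero = f zero by rewrite -H1 Hl.
have fg1 : g one = f one by rewrite -H1 Hr.
exists (fun u => if unitI_val u.2 <= 2^-1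
  then H (u.1, clampI (2 * unitI_val u.2 + 0))
  else K (u.1, clampI (2 * unitI_val u.2 + (-1)))); split => [|t|t|s|s] /=.
- apply: (@continuous_paste _ _ _ (fun u : I * I => unitI_val u.2)).
  + by move=> v; apply: continuous_comp;
      [exact: cvg_snd|exact: unitI_val_continuous].
  + by move=> v; apply: (@continuous_comp _ _ _
      (fun u : I * I => (u.1, clampI (2 * unitI_val u.2 + 0))) H);
      [exact: continuous_clamp_snd|exact: cH].
  + by move=> v; apply: (@continuous_comp _ _ _
      (fun u : I * I => (u.1, clampI (2 * unitI_val u.2 + (-1)))) K);
      [exact: continuous_clamp_snd|exact: cK].
  + by move=> v ->; rewrite divff// addr0 subrr H1 K0.
- by rewrite unitI_val0 invr_ge0 ler0n mulr0 addr0 H0.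
- rewrite unitI_val1 leNgt invf_lt1 ?ltr0n// ltr1n/= mulr1.
  by rewrite -[2 : R]/(1 + 1) addrK K1.
- by case: ifP; rewrite ?Hl ?Kl.
- by case: ifP; rewrite ?Hr ?Kr.
Qed.

Context (x0 : X).

Definition based_path := {y : X & {path I from x0 to y in X}}.

HB.instance Definition _ := Choice.on based_path.

Definition homotopic_rel (a b : based_path) : bool :=
  `[< path_homotopic (tagged a) (tagged b) >].

Lemma homotopic_rel_refl : reflexive homotopic_rel.
Proof. by move=> a; apply/asboolP/path_homotopic_refl/cts_fun. Qed.

Lemma homotopic_rel_sym : symmetric homotopic_rel.
Proof.
by move=> a b; apply/idP/idP => /asboolP ab;
  apply/asboolP/path_homotopic_sym.
Qed.

Lemma homotopic_rel_trans : transitive homotopic_rel.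
Proof.
move=> b a c /asboolP ab /asboolP bc; apply/asboolP.
exact: path_homotopic_trans ab bc.
Qed.

Canonical homotopic_equiv := EquivRel homotopic_rel
  homotopic_rel_refl homotopic_rel_sym homotopic_rel_trans.

Definition path_space : Type := {eq_quot homotopic_equiv}.

Definition path_class (y : X) (p : {path I from x0 to y in X}) : path_space :=
  \pi_({eq_quot homotopic_equiv}) (Tagged _ p).

Lemma path_classP (y z : X) (p : {path I from x0 to y in X})
    (q : {path I from x0 to z in X}) :
  path_class p = path_class q <-> path_homotopic p q.
Proof. by split=> [/eqmodP/asboolP|pq]//; apply/eqmodP/asboolP. Qed.

End PathOperations.

Arguments path_space R {X} x0.

Section Uniformities.
Context (R : realType) (X : uniformType).
Local Notation I := (unitI R).

Definition sym_entourage : set_system (X * X) :=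
  [set E | entourage E /\ (E^-1)%relation = E].

(* [xsection E x] is B(x, E). *)
Definition ent_bounded (E : set (X * X)) (A : set X) : Prop :=
  exists x, A `<=` xsection E x.

Definition unif_loc_path_connected : Prop :=
  forall E, sym_entourage E -> exists2 F, sym_entourage F &
    forall x y, F (x, y) ->
      exists p : {path I from x to y}, ent_bounded E (range p).

Inductive lasso (E : set (X * X)) (x : X) : {path I from x to x} -> Prop :=
| lasso_loop (y : X) (alpha : {path I from x to y})
    (gamma : {path I from y to y}) : ent_bounded E (range gamma) ->
    lasso E (path_cat (path_cat alpha gamma) (path_rev alpha))
| lasso_cat (l l' : {path I from x to x}) :
    lasso E l -> lasso E l' -> lasso E (path_cat l l').

Context (x0 : X).

Definition james_ent (E : set (X * X)) :
    set (path_space R x0 * path_space R x0) :=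
  [set ab | exists (y z : X) (alpha : {path I from x0 to y})
      (beta : {path I from x0 to z}),
    ab = (path_class alpha, path_class beta) /\
    forall t, E (alpha t, beta t)].

Definition lasso_ent (E : set (X * X)) :
    set (path_space R x0 * path_space R x0) :=
  [set ab | exists (y z : X) (alpha : {path I from x0 to y})
      (beta : {path I from x0 to z}),
    ab = (path_class alpha, path_class beta) /\
    exists (l : {path I from x0 to x0}) (p : {path I from y to z}),
      [/\ lasso E l, ent_bounded E (range p) &
        path_homotopic (path_cat (path_cat (path_rev alpha) l) beta) p]].

(* A uniform structure is identified with its set of entourages, as in
   [uniformType]; filter_from gives all supersets of the basic sets. *)
Definition james_uniformity : set_system (path_space R x0 * path_space R x0) :=
  filter_from sym_entourage james_ent.

Definition lasso_uniformity : set_system (path_space R x0 * path_space R x0) :=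
  filter_from sym_entourage lasso_ent.

End Uniformities.

Arguments unif_loc_path_connected R X : clear implicits.
Arguments james_uniformity R {X} x0.
Arguments lasso_uniformity R {X} x0.

(* Main.v *)
Require Import Defs.
From mathcomp Require Import all_boot all_order all_algebra.
From mathcomp Require Import all_classical all_reals all_analysis homotopy.
From mathcomp Require Import lra.
From Corelib Require Setoid.
Import Order.TTheory GRing.Theory Num.Theory numFieldNormedType.Exports.

(** Both uniformities are compared on basic entourages; write [p . q] for
    concatenation and [~] for homotopy rel. end-points.

    Lasso-close implies James-close.  Suppose [a^-1 . l . b ~ p], where [l] is
    an F-lasso and [p] is F-bounded.  Then [b ~ l^-1 . a . p].  Collapsing each
    small loop of the lasso to its base point turns [l] into a loop [l0] that
    runs along the tails and back, hence is null-homotopic, and that stays close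
    to [l] at every time.  So [l0^-1 . a . cst ~ a] and [l^-1 . a . p ~ b] are
    representatives that are close at every time ([lasso_close],
    [lasso_sub_james]).

    James-close implies lasso-close.  Suppose that [a t] and [b t] are close for
    all [t].  Say that a time [r] is swept if, for every small path [p] from
    [a r] to [b r], the loop [a|[0,r] . p . (b|[0,r])^-1] is homotopic to an
    E-lasso.  Time 0 is swept, since this loop is then [p] itself.  If [r] is
    swept and [s] is near [r], uniform local path-connectedness gives a small
    path [q] from [a r] to [b r], and
    [[
      a|[0,s] . p . (b|[0,s])^-1
        ~ (a|[0,r] . (a|[r,s] . p . b|[s,r] . q^-1) . (a|[0,r])^-1)
            . (a|[0,r] . q . (b|[0,r])^-1),
    ]]
    where the inner parenthesis is a small loop; so [s] is swept
    ([swept_step]).  The line being connected, time 1 is swept ([swept_all]),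
    and this is the claim ([james_sub_lasso]).

    The groupoid laws for [~] all come from one fact: two paths that factor
    through the same map from the real line, and have the same end-points there,
    are homotopic, because the line is convex ([homotopic_in_line]). *)

Set Implicit Arguments.
Unset Strict Implicit.
Unset Printing Implicit Defensive.

Local Open Scope classical_set_scope.
Local Open Scope ring_scope.

(** * Paths that factor through the real line *)

Section Segments.
Context (R : realType) (X : topologicalType).
Local Notation I := (unitI R).
Implicit Types (f : R -> X) (a b c : R) (x y z : X).

Definition affine a b (t : I) : R := a + unitI_val t * (b - a).

Lemma continuous_interpolate (T : topologicalType) (c u v : T -> R) :
  continuous c -> continuous u -> continuous v ->
  continuous (fun t => u t + c t * (v t - u t)).
Proof.
move=> cc cu cv t; apply: cvgD; first exact: cu.
by apply: cvgM; [exact: cc|apply: cvgB; [exact: cv|exact: cu]].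
Qed.

Lemma affine_continuous a b : continuous (affine a b).
Proof.
apply: (@continuous_interpolate _ (@unitI_val R) (cst a) (cst b)).
- exact: unitI_val_continuous.
- exact: cst_continuous.
- exact: cst_continuous.
Qed.

Lemma affine0 a b : affine a b zero = a.
Proof. by rewrite /affine unitI_val0 mul0r addr0. Qed.

Lemma affine1 a b : affine a b one = b.
Proof. by rewrite /affine unitI_val1 mul1r addrC subrK. Qed.

Lemma homotopic_in_line f (phi psi : I -> R) : continuous f ->
  continuous phi -> continuous psi ->
  phi zero = psi zero -> phi one = psi one ->
  path_homotopic (f \o phi) (f \o psi).
Proof.
move=> cf cphi cpsi e0 e1.
exists (fun u => f (phi u.1 + unitI_val u.2 * (psi u.1 - phi u.1))).
split => [u|t|t|s|s] /=.
- apply: (@continuous_comp _ _ _ (fun u : I * I =>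
    phi u.1 + unitI_val u.2 * (psi u.1 - phi u.1)) f); last exact: cf.
  apply: (@continuous_interpolate _ (fun u : I * I => unitI_val u.2)
    (phi \o fst) (psi \o fst)) => v; apply: continuous_comp.
  + exact: cvg_snd.
  + exact: unitI_val_continuous.
  + exact: cvg_fst.
  + exact: cphi.
  + exact: cvg_fst.
  + exact: cpsi.
- by rewrite unitI_val0 mul0r addr0.
- by rewrite unitI_val1 mul1r addrC subrK.
- by rewrite -e0 subrr mulr0 addr0.
- by rewrite -e1 subrr mulr0 addr0.
Qed.

Section Seg.
(* The end-points [x] and [y] are only propositionally equal to [f a] and [f b],
   so that segments of one map can be concatenated with paths whose end-points
   are given by other names. *)
Context f (cf : continuous f) a b x y (fa : f a = x) (fb : f b = y).

Lemma seg_continuous : continuous (f \o affine a b).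
Proof.
by move=> t; apply: continuous_comp; [exact: affine_continuous|exact: cf].
Qed.

Lemma seg0 : (f \o affine a b) zero = x.
Proof. by rewrite /= affine0. Qed.

Lemma seg1 : (f \o affine a b) one = y.
Proof. by rewrite /= affine1. Qed.

Definition seg : {path I from x to y} := mk_path seg_continuous seg0 seg1.

End Seg.

Lemma catE x y z (p : {path I from x to y}) (q : {path I from y to z}) t :
  path_cat p q t = cat_fun p q t.
Proof. by []. Qed.

Lemma revE x y (p : {path I from x to y}) t : path_rev p t = rev_fun p t.
Proof. by []. Qed.

(** The typed restriction of [path_homotopic]: only on paths with matching
    end-points is concatenation a congruence, which rewriting requires. *)
Definition homot x y (p q : {path I from x to y}) : Prop := path_homotopic p q.

Lemma homot_refl x y (p : {path I from x to y}) : homot p p.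
Proof. by apply/path_homotopic_refl/cts_fun. Qed.

Lemma homot_sym x y (p q : {path I from x to y}) : homot p q -> homot q p.
Proof. by move/path_homotopic_sym. Qed.

Lemma homot_trans x y (p q r : {path I from x to y}) :
  homot p q -> homot q r -> homot p r.
Proof. exact: path_homotopic_trans. Qed.

End Segments.

Local Notation "p ~~> q" := (homot p q) (at level 70).
Local Notation "p ** q" := (path_cat p q) (at level 50, left associativity).

Add Parametric Relation (R : realType) (X : topologicalType) (x y : X) :
  {path unitI R from x to y} (@homot R X x y)
  reflexivity proved by (@homot_refl R X x y)
  symmetry proved by (@homot_sym R X x y)
  transitivity proved by (@homot_trans R X x y) as homot_rel.

#[local] Hint Resolve homot_refl : core.

(** * The fundamental groupoid *)

Section Congruence.
Context (R : realType) (X : topologicalType).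
Local Notation I := (unitI R).

Lemma continuous_val_fst : continuous (fun u : I * I => unitI_val u.1).
Proof.
by move=> u; apply: continuous_comp; [exact: cvg_fst|exact: unitI_val_continuous].
Qed.

Lemma continuous_clamp_fst (a b : R) :
  continuous (fun u : I * I => (clampI (a * unitI_val u.1 + b), u.2)).
Proof.
have cA := continuous_affine_clampI (a := a) (b := b) continuous_val_fst.
by move=> [t s]; exact: cvg_pair (cA (t, s)) (@cvg_snd _ _ _ _ _).
Qed.

Lemma homot_cat (x y z : X) (p p' : {path I from x to y})
    (q q' : {path I from y to z}) :
  p ~~> p' -> q ~~> q' -> p ** q ~~> p' ** q'.
Proof.
move=> [H [cH H0 H1 Hl Hr]] [K [cK K0 K1 Kl Kr]].
exists (fun u => if unitI_val u.1 <= 2^-1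
  then H (clampI (2 * unitI_val u.1 + 0), u.2)
  else K (clampI (2 * unitI_val u.1 + (-1)), u.2)); split => [|t|t|s|s] /=.
- apply: (@continuous_paste _ _ _ (fun u : I * I => unitI_val u.1)).
  + exact: continuous_val_fst.
  + move=> v; apply: (@continuous_comp _ _ _
      (fun u : I * I => (clampI (2 * unitI_val u.1 + 0), u.2)) H); last exact: cH.
    exact: continuous_clamp_fst.
  + move=> v; apply: (@continuous_comp _ _ _
      (fun u : I * I => (clampI (2 * unitI_val u.1 + -1), u.2)) K); last exact: cK.
    exact: continuous_clamp_fst.
  + move=> v ->; rewrite divff// addr0 subrr.
    by rewrite -[clampI 1]/one -[clampI 0]/zero Hr Kl path_one path_zero.
- by rewrite /cat_fun addr0 H0 K0.
- by rewrite /cat_fun addr0 H1 K1.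
- rewrite unitI_val0 invr_ge0 ler0n mulr0 addr0 -[clampI 0]/zero Hl.
  by rewrite !path_zero.
- rewrite unitI_val1 leNgt invf_lt1 ?ltr0n// ltr1n/= mulr1.
  by rewrite -[2 : R]/(1 + 1) addrK -[clampI 1]/one Kr !path_one.
Qed.

Lemma homot_rev (x y : X) (p p' : {path I from x to y}) :
  p ~~> p' -> path_rev p ~~> path_rev p'.
Proof.
move=> [H [cH H0 H1 Hl Hr]].
exists (fun u => H (clampI (-1 * unitI_val u.1 + 1), u.2)).
have E (t : I) : clampI (-1 * unitI_val t + 1) = clampI (1 - unitI_val t).
  by rewrite mulN1r addrC.
split => [v|t|t|s|s] /=.
- apply: (@continuous_comp _ _ _
    (fun u : I * I => (clampI (-1 * unitI_val u.1 + 1), u.2)) H); last exact: cH.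
  exact: continuous_clamp_fst.
- by rewrite E H0.
- by rewrite E H1.
- by rewrite E unitI_val0 subr0 -[clampI 1]/one Hr path_zero path_one.
- by rewrite E unitI_val1 subrr -[clampI 0]/zero Hl path_one path_zero.
Qed.

End Congruence.

#[local] Instance cat_proper (R : realType) (X : topologicalType) (x y z : X) :
  Morphisms.Proper (Morphisms.respectful (@homot R X x y)
    (Morphisms.respectful (@homot R X y z) (@homot R X x z))) (@path_cat R X x y z).
Proof. by move=> p p' pp' q q' qq'; exact: homot_cat. Qed.

#[local] Instance rev_proper (R : realType) (X : topologicalType) (x y : X) :
  Morphisms.Proper (Morphisms.respectful (@homot R X x y) (@homot R X y x))
    (@path_rev R X x y).
Proof. by move=> p p' pp'; exact: homot_rev. Qed.

Section Groupoid.
Context (R : realType) (X : topologicalType).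
Local Notation I := (unitI R).
Implicit Types (x y z w : X).

Lemma segE (f : R -> X) (cf : continuous f) a b x y
  (fa : f a = x) (fb : f b = y) t : seg cf fa fb t = f (affine a b t).
Proof. by []. Qed.

(** Every groupoid law below is an instance of this one: the paths involved are
    written as segments of a single map on the line. *)
Lemma seg_cat (f : R -> X) (cf : continuous f) (a b c : R) x y z
    (fa : f a = x) (fb : f b = y) (fc : f c = z) :
  seg cf fa fb ** seg cf fb fc ~~> seg cf fa fc.
Proof.
pose ab : {path I from a to b in R} := mk_path
  (@affine_continuous R a b) (affine0 a b) (affine1 a b).
pose bc : {path I from b to c in R} := mk_path
  (@affine_continuous R b c) (affine0 b c) (affine1 b c).
rewrite /homot.
have -> : (seg cf fa fb ** seg cf fb fc : I -> X) = f \o path_cat ab bc.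
  by apply/funext => t; rewrite /= catE catE /cat_fun; case: ifP.
have -> : (seg cf fa fc : I -> X) = f \o affine a c by [].
apply: homotopic_in_line => //.
- exact: cat_fun_continuous.
- exact: affine_continuous.
- by rewrite path_zero affine0.
- by rewrite path_one affine1.
Qed.

Definition cst_path x : {path I from x to x} :=
  mk_path (cst_continuous (x := x)) erefl erefl.

Section Line.
Context x y (p : {path I from x to y}).

Lemma line_continuous : continuous (p \o @clampI R).
Proof.
by move=> t; apply: continuous_comp; [exact: clampI_continuous|exact: cts_fun].
Qed.

Lemma line0 : (p \o @clampI R) 0 = x.
Proof. by rewrite /= -[clampI 0]/zero path_zero. Qed.

Lemma line1 : (p \o @clampI R) 1 = y.
Proof. by rewrite /= -[clampI 1]/one path_one. Qed.

(** Extending [p] by constants to the whole line makes [p] and its reverse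
    segments of one map. *)
Lemma line_seg : p = seg line_continuous line0 line1.
Proof.
by apply/path_eqP => t; rewrite segE /= /affine subr0 mulr1 add0r unitI_valK.
Qed.

Lemma rev_seg : path_rev p = seg line_continuous line1 line0.
Proof.
by apply/path_eqP => t; rewrite segE revE /rev_fun /= /affine sub0r mulrN mulr1.
Qed.

End Line.

Lemma cst_seg (f : R -> X) (cf : continuous f) (a : R) x (fa : f a = x) :
  cst_path x = seg cf fa fa.
Proof. by apply/path_eqP => t; rewrite segE /affine subrr mulr0 addr0. Qed.

Lemma homot_cat_cst x y (p : {path I from x to y}) : p ** cst_path y ~~> p.
Proof.
rewrite (line_seg p) (cst_seg (@line_continuous _ _ p) (line1 p)).
exact: seg_cat.
Qed.

Lemma homot_cst_cat x y (p : {path I from x to y}) : cst_path x ** p ~~> p.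
Proof.
rewrite (line_seg p) (cst_seg (@line_continuous _ _ p) (line0 p)).
exact: seg_cat.
Qed.

Lemma homot_cat_rev x y (p : {path I from x to y}) :
  p ** path_rev p ~~> cst_path x.
Proof.
rewrite [X in X ** _](line_seg p) rev_seg.
rewrite (cst_seg (@line_continuous _ _ p) (line0 p)).
exact: seg_cat.
Qed.

Lemma homot_rev_cat x y (p : {path I from x to y}) :
  path_rev p ** p ~~> cst_path y.
Proof.
rewrite [X in _ ** X](line_seg p) rev_seg.
rewrite (cst_seg (@line_continuous _ _ p) (line1 p)).
exact: seg_cat.
Qed.

(** Lay [p], [q] and [r] end to end on [0, 3]: both bracketings then are
    homotopic to the segment from 0 to 3. *)
Lemma homot_catA x y z w (p : {path I from x to y}) (q : {path I from y to z})
    (r : {path I from z to w}) : p ** q ** r ~~> p ** (q ** r).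
Proof.
(* The coefficient 1 gives the form that [continuous_affine_clampI] expects. *)
pose qr (t : R) :=
  if t <= 2 then q (clampI (1 * t + -1)) else r (clampI (1 * t + -2)).
pose g (t : R) := if t <= 1 then p (clampI t) else qr t.
have cid : continuous (@id R) by move=> t; exact: cvg_id.
have caff (u v : X) (s : {path I from u to v}) (b : R) :
    continuous (fun t : R => s (clampI (1 * t + b))).
  move=> t; apply: (@continuous_comp _ _ _ (fun t : R => clampI (1 * t + b)) s);
    last exact: cts_fun.
  exact: (continuous_affine_clampI cid).
have cqr : continuous qr.
  apply: (@continuous_paste R _ _ id) => // t ->.
  rewrite !mul1r subrr (_ : 2 + -1 = 1 :> R); last by lra.
  by rewrite -[clampI 1]/one -[clampI 0]/zero path_zero path_one.
have qr1 : qr 1 = y.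
  by rewrite /qr ler1n mul1r subrr -[clampI 0]/zero path_zero.
have cg : continuous g.
  apply: (@continuous_paste R _ _ id) => //; first exact: line_continuous.
  by move=> t ->; rewrite qr1 -[clampI 1]/one path_one.
have g0 : g 0 = x by rewrite /g ler01 -[clampI 0]/zero path_zero.
have g1 : g 1 = y by rewrite /g lexx -[clampI 1]/one path_one.
have g2 : g 2 = z.
  rewrite /g ifF /qr; last by apply/negbTE; rewrite -ltNge ltr1n.
  rewrite lexx mul1r (_ : 2 + -1 = 1 :> R); last by lra.
  by rewrite -[clampI 1]/one path_one.
have g3 : g 3 = w.
  rewrite /g ifF /qr; last by apply/negbTE; rewrite -ltNge ltr1n.
  rewrite ifF; last by apply/negbTE; rewrite -ltNge ltr_nat.
  rewrite mul1r (_ : 3 + -2 = 1 :> R); last by lra.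
  by rewrite -[clampI 1]/one path_one.
have -> : p = seg cg g0 g1.
  apply/path_eqP => t; rewrite segE /affine subr0 mulr1 add0r /g.
  by rewrite unitI_le1 unitI_valK.
have -> : q = seg cg g1 g2.
  apply/path_eqP => t; rewrite segE /affine (_ : 2 - 1 = 1 :> R); last by lra.
  have t0 := unitI_ge0 t; have t1 := unitI_le1 t.
  (* At the junction [g] is defined by the piece on the left. *)
  rewrite mulr1; case: (eqVneq (unitI_val t) 0) => [t00|tn0].
    by rewrite t00 addr0 g1 -[t]unitI_valK t00 -[clampI 0]/zero path_zero.
  rewrite /g ifF /qr; last by apply/negbTE; rewrite -ltNge ltrDl lt_def tn0.
  rewrite ifT; last by lra.
  by rewrite mul1r addrC addKr unitI_valK.
have -> : r = seg cg g2 g3.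
  apply/path_eqP => t; rewrite segE /affine (_ : 3 - 2 = 1 :> R); last by lra.
  have t0 := unitI_ge0 t.
  rewrite mulr1; case: (eqVneq (unitI_val t) 0) => [t00|tn0].
    by rewrite t00 addr0 g2 -[t]unitI_valK t00 -[clampI 0]/zero path_zero.
  have tp : 0 < unitI_val t by rewrite lt_def tn0.
  rewrite /g ifF /qr; last by apply/negbTE; rewrite -ltNge; lra.
  rewrite ifF; last by apply/negbTE; rewrite -ltNge; lra.
  by rewrite mul1r addrC addKr unitI_valK.
by rewrite !seg_cat.
Qed.

Lemma homot_cat_revK x y z (p : {path I from x to y}) (q : {path I from x to z}) :
  p ** (path_rev p ** q) ~~> q.
Proof. by rewrite -homot_catA homot_cat_rev homot_cst_cat. Qed.

Lemma homot_rev_catK x y z (p : {path I from x to y}) (q : {path I from y to z}) :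
  path_rev p ** (p ** q) ~~> q.
Proof. by rewrite -homot_catA homot_rev_cat homot_cst_cat. Qed.

End Groupoid.

(** * Pointwise control of concatenations *)

Section Closeness.
Context (R : realType).
Local Notation I := (unitI R).

Lemma rev_cst (X : topologicalType) (x : X) :
  path_rev (cst_path R x) = cst_path R x.
Proof. by apply/path_eqP. Qed.

Lemma cat_within (X : topologicalType) (P : X -> Prop) (x y z : X)
    (p : {path I from x to y}) (q : {path I from y to z}) :
  (forall t, P (p t)) -> (forall t, P (q t)) -> forall t, P (path_cat p q t).
Proof. by move=> Pp Pq t; rewrite catE /cat_fun; case: ifP. Qed.

Lemma cat_close (X : topologicalType) (E : set (X * X)) (x y z x' y' z' : X)
    (p : {path I from x to y}) (q : {path I from y to z})
    (p' : {path I from x' to y'}) (q' : {path I from y' to z'}) :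
  (forall t, E (p t, p' t)) -> (forall t, E (q t, q' t)) ->
  forall t, E (path_cat p q t, path_cat p' q' t).
Proof. by move=> Ep Eq t; rewrite !catE /cat_fun; case: ifP. Qed.

End Closeness.

(** * Propagation along the line *)

Section Propagation.
Context (R : realType).

(** The hypothesis says that both [P] and its complement are open.  This
    replaces a subdivision of the interval by a Lebesgue number. *)
Lemma connected_line_ind (P : R -> Prop) (a : R) :
    (forall r, exists2 e, 0 < e &
      forall s t, ball r e s -> ball r e t -> P s -> P t) ->
  P a -> forall b, P b.
Proof.
move=> Ploc Pa b.
have cR : connected [set: R] by exact/connected_intervalP.
suff -> : P = [set: R] by [].
apply: cR; first by exists a.
- exists P; last by rewrite setTI.
  rewrite openE => r Pr; have [e e0 Pe] := Ploc r.
  apply/nbhs_ballP; exists e => // s rs.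
  exact: Pe (ballxx _ _) rs Pr.
- exists P; last by rewrite setTI.
  move=> r rP; have [e e0 Pe] := Ploc r.
  have [s [Ps rs]] := rP _ (nbhsx_ballx r e e0).
  exact: Pe rs (ballxx _ _) Ps.
Qed.

Lemma ball_affine (r e s t : R) (u : unitI R) :
  ball r e s -> ball r e t -> ball r e (affine s t u).
Proof.
rewrite /ball /= !ltr_distlC /affine => /andP[rs sr] /andP[rt tr].
have u0 := unitI_ge0 u; have u1 := unitI_le1 u.
by case: (lerP s t) => st; apply/andP; split; nra.
Qed.

End Propagation.

(** * From lassos to pairs of close paths *)

Section Entourages.
Context (R : realType) (X : uniformType).
Local Notation I := (unitI R).
Implicit Types E F H : set (X * X).

Lemma sym_entourageC E x y : sym_entourage E -> E (x, y) -> E (y, x).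
Proof. by move=> [_ {2}<-]. Qed.

Lemma entourage_split_sym E : entourage E -> exists2 H, sym_entourage H &
  forall x y z, H (x, y) -> H (y, z) -> E (x, z).
Proof.
move=> eE; pose S := split_ent E.
have eS : entourage S by exact: entourage_split_ent.
exists (S `&` (S^-1)%relation); first split.
- by apply: filterI => //; exact: entourage_inv.
- by apply/seteqP; split=> -[x y] [].
- by move=> x y z [xy _] [yz _]; apply: (entourage_split y).
Qed.

Lemma ent_boundedP E (x y : X) (p : {path I from x to y}) :
  ent_bounded E (range p) <-> exists c, forall t, E (c, p t).
Proof.
split=> -[c cp]; exists c.
- by move=> t; have := cp _ (imageT p t); rewrite /xsection /= inE.
- by move=> _ [t _ <-]; rewrite /xsection /= inE.
Qed.

Variable x0 : X.

(** [l0] is [l] with every small loop replaced by the constant loop at its base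
    point; what remains of each factor is a tail followed by its reverse. *)
Lemma lasso_close E F (l : {path I from x0 to x0}) : sym_entourage F ->
    (forall x y z, F (x, y) -> F (y, z) -> E (x, z)) -> entourage E ->
    lasso F l ->
  exists l0 l1 : {path I from x0 to x0},
    [/\ l0 ~~> cst_path R x0, l1 ~~> l & forall t, E (l0 t, l1 t)].
Proof.
move=> sF FFE eE; elim=> {l} [y a c /ent_boundedP[w wc]|l l' _ [m [n [m0 nl mn]]]
    _ [m' [n' [m'0 n'l' mn']]]].
- exists (a ** cst_path R y ** path_rev a), (a ** c ** path_rev a); split=> //.
  + by rewrite homot_cat_cst homot_cat_rev.
  + apply: cat_close => [|t]; last exact: entourage_refl.
    apply: cat_close => t; first exact: entourage_refl.
    (* [y] and [c t] are both F-close to the center [w] of a ball around [c]. *)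
    have := sym_entourageC sF (wc zero); rewrite path_zero => yw.
    exact: FFE yw (wc t).
- exists (m ** m'), (n ** n'); split.
  + by rewrite m0 m'0 homot_cat_cst.
  + by rewrite nl n'l'.
  + exact: cat_close.
Qed.

Lemma lasso_sub_james E : sym_entourage E ->
  exists2 F, sym_entourage F & lasso_ent (R := R) (x0 := x0) F `<=` james_ent E.
Proof.
move=> [eE _]; have [F sF FFE] := entourage_split_sym eE.
exists F => // _ [y [z [a [b [-> [l [p [Fl /ent_boundedP[w wp] albp]]]]]]]].
have [l0 [l1 [l0c l1l l01]]] := lasso_close sF FFE eE Fl.
have {}albp : path_rev a ** l ** b ~~> p by exact: albp.
(* The constant path accompanies [p], whose points are all close to [y]. *)
exists y, z, (path_rev l0 ** a ** cst_path R y), (path_rev l1 ** a ** p); split.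
- congr (_, _); apply/path_classP/path_homotopic_sym.
  + change (path_rev l0 ** a ** cst_path R y ~~> a).
    by rewrite l0c rev_cst homot_cat_cst homot_cst_cat.
  + change (path_rev l1 ** a ** p ~~> b).
    by rewrite l1l -albp !homot_catA homot_cat_revK homot_rev_catK.
- apply: cat_close => [|t].
    apply: cat_close => t; last exact: entourage_refl.
    exact: l01.
  have := sym_entourageC sF (wp zero); rewrite path_zero => yw.
  exact: FFE yw (wp t).
Qed.

(** * From pairs of close paths to lassos *)

Lemma locally_small E (f : R -> X) (r : R) : entourage E -> continuous f ->
  exists2 e, 0 < e & forall s t, ball r e s -> ball r e t -> E (f s, f t).
Proof.
move=> eE cf; have [H sH HHE] := entourage_split_sym eE.
have /cf/nbhs_ballP[e e0 He] : nbhs (f r) (xsection H (f r)).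
  by apply: nbhs_entourage; case: sH.
exists e => // s t /He + /He; rewrite /xsection /= !inE => rs rt.
exact: HHE (sym_entourageC sH rs) rt.
Qed.

Section SweepLasso.
Context (E K H : set (X * X)).
Hypotheses (eK : entourage K) (sH : sym_entourage H).
Hypothesis KKE : forall x y z, K (x, y) -> K (y, z) -> E (x, z).
Hypothesis HHK : forall x y z, H (x, y) -> H (y, z) -> K (x, z).
Context (f g : R -> X) (cf : continuous f) (cg : continuous g).
Context (f0 : f 0 = x0) (g0 : g 0 = x0).
Hypothesis fgH : forall r, exists p : {path I from f r to g r},
  ent_bounded H (range p).

(** Quantifying over all small paths [p], rather than fixing one for each time,
    lets the induction step choose the path [q] at the old time freely.  The
    return along [g] is a segment run backwards, so that [seg_cat] also cuts the
    returning part; the end-points [a] and [b] are variables so that they can be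
    [x0] at time 0 and the given end-points at time 1. *)
Definition swept (r : R) : Prop := forall (a b : X) (fa : f r = a) (gb : g r = b)
  (p : {path I from a to b}), ent_bounded H (range p) ->
  exists2 l, lasso E l & seg cf f0 fa ** p ** seg cg gb g0 ~~> l.

Lemma H_sub_K x y : H (x, y) -> K (x, y).
Proof. by apply: HHK; apply: entourage_refl; case: sH. Qed.

Lemma K_sub_E x y : K (x, y) -> E (x, y).
Proof. by apply: KKE; exact: entourage_refl. Qed.

Lemma swept0 : swept 0.
Proof.
move=> a b fa gb.
have [ax bx] : a = x0 /\ b = x0 by rewrite -fa -gb.
move: fa gb; rewrite ax bx => fa gb p /ent_boundedP[c cp].
exists (cst_path R x0 ** p ** path_rev (cst_path R x0)).
  apply: lasso_loop; apply/ent_boundedP; exists c => t.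
  exact/K_sub_E/H_sub_K.
by rewrite (Prop_irrelevance fa f0) (Prop_irrelevance gb g0) -!cst_seg rev_cst.
Qed.

(** The loop at time [t] is the loop at time [s], closed up by [q], preceded by
    the lasso with tail [f] on [0, s] around the quadrilateral made of the two
    short segments of [f] and [g], of [p] and of the reverse of [q]. *)
Lemma swept_step r e s t :
  (forall u v, ball r e u -> ball r e v -> H (f u, f v)) ->
  (forall u v, ball r e u -> ball r e v -> H (g u, g v)) ->
  ball r e s -> ball r e t -> swept s -> swept t.
Proof.
move=> Hf Hg rs rt Ps a b fa gb p /ent_boundedP[c cp].
have [q qH] := fgH s; have [l El Al] := Ps _ _ erefl erefl q qH.
have [d dq] := (ent_boundedP _ _).1 qH.
pose A := seg cf f0 (erefl (f s)).
pose loop := seg cf (erefl (f s)) fa ** p ** seg cg gb (erefl (g s)) ** path_rev q.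
exists ((A ** loop ** path_rev A) ** l); last first.
  rewrite -(seg_cat cf f0 (erefl (f s)) fa) -(seg_cat cg gb (erefl (g s)) g0).
  by rewrite -Al /loop /A !homot_catA !homot_rev_catK.
apply: lasso_cat => //; apply: lasso_loop; apply/ent_boundedP; exists (f s).
(* The quadrilateral is followed from [f s]: each point is reached within at
   most four steps of size [H], that is, two steps of size [K]. *)
have Hs := sym_entourageC sH.
have qK u : K (f s, q u).
  by apply: HHK (dq u); apply: Hs; rewrite -(path_zero (s := q)).
have gsK u : K (g s, g (affine t s u)).
  by apply/H_sub_K/Hg => //; exact: ball_affine.
have pK u : K (f t, p u).
  by apply: HHK (cp u); apply: Hs; rewrite fa -(path_zero (s := p)).
have fsK u : H (f s, f (affine s t u)) by apply: Hf => //; exact: ball_affine.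
apply: (cat_within (P := fun v => E (f s, v))) => [|u]; last exact/K_sub_E/qK.
apply: (cat_within (P := fun v => E (f s, v))) => [|u].
  apply: (cat_within (P := fun v => E (f s, v))) => u.
    exact/K_sub_E/H_sub_K/fsK.
  by apply: KKE (pK u); apply/H_sub_K/Hf.
by apply: KKE (gsK u); have := qK one; rewrite path_one.
Qed.

Lemma swept_all r : swept r.
Proof.
apply: connected_line_ind swept0 r => r.
have [eH _] := sH.
have [e e0 He] := locally_small r eH cf.
have [e' e'0 He'] := locally_small r eH cg.
exists (Num.min e e'); first by rewrite lt_min e0.
by move=> s t; apply: swept_step => u v ru rv; [apply: He|apply: He'];
  (apply: le_ball; last eassumption); rewrite ge_min lexx ?orbT.
Qed.

End SweepLasso.

Lemma james_sub_lasso E : unif_loc_path_connected R X -> sym_entourage E ->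
  exists2 F, sym_entourage F & james_ent (R := R) (x0 := x0) F `<=` lasso_ent E.
Proof.
move=> ulpc [eE _].
have [K [eK sK] KKE] := entourage_split_sym eE.
have [H sH HHK] := entourage_split_sym eK.
have [F sF FH] := ulpc H sH.
exists F => // _ [y [z [a [b [-> Fab]]]]].
have FHab (r : R) := FH _ _ (Fab (clampI r)).
have := @swept_all E K H eK sH KKE HHK _ _
  (@line_continuous _ _ _ _ a) (@line_continuous _ _ _ _ b)
  (line0 a) (line0 b) FHab 1 _ _ (line1 a) (line1 b).
have := Fab one; rewrite !path_one => /FH[p pH] /(_ p pH) [l El].
rewrite -line_seg -rev_seg => apbl.
exists y, z, a, b; split => //; exists l, p; split => //.
  have [c cp] := (ent_boundedP _ _).1 pH.
  apply/ent_boundedP; exists c => t; apply: (KKE _ c).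
    exact: entourage_refl.
  by apply: HHK (cp t); apply: entourage_refl; case: sH.
change (path_rev a ** l ** b ~~> p).
by rewrite -apbl !homot_catA homot_rev_catK homot_rev_cat homot_cat_cst.
Qed.

End Entourages.

Theorem corollary5p16 (R : realType) (X : uniformType) (x0 : X)
    (X_connected : connected [set: X])
    (X_ulpc : unif_loc_path_connected R X) :
  james_uniformity R x0 = lasso_uniformity R x0.
Proof.
apply/seteqP; split=> A [E sE EA].
- have [F sF FE] := lasso_sub_james R x0 sE.
  by exists F => //; exact: subset_trans FE EA.
- have [F sF FE] := james_sub_lasso x0 X_ulpc sE.
  by exists F => //; exact: subset_trans FE EA.
Qed.
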